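(* Let $(P)$ be any one of the properties (O5), (O6), (O7). Given a $\mathrm{Cu}$-semigroup $S$ satisfying $(P)$, the countably based sub-$\mathrm{Cu}$-semigroups of $S$ satisfying $(P)$ form a $\sigma$-complete, cofinal subset of $\mathrm{Sub}_{\mathrm{ctbl}}(S)$. In particular, the properties (O5), (O6) and (O7) each satisfy the L\''owenheim-Skolem condition.
   Context: Way-below relation: in a partially ordered set, $x\ll y$ means that for every increasing sequence $(z_n)_n$ that has a supremum $z$ with $y\leq z$ there exists $n$ with $x\leq z_n$. A $\mathrm{Cu}$-semigroup is an abelian monoid $S$ with a partial order such that $0\leq x$ for all $x$, and $x\leq y$ implies $x+z\leq y+z$, satisfying: (O1) every increasing sequence has a supremum; (O2) every element is the supremum of a $\ll$-increasing sequence (i.e. $x_n\ll x_{n+1}$ for all $n$); (O3) $x'\ll x$ and $y'\ll y$ imply $x'+y'\ll x+y$; (O4) $\sup_n x_n+\sup_n y_n=\sup_n(x_n+y_n)$ for increasing sequences $(x_n)_n,(y_n)_n$. A $\mathrm{Cu}$-morphism is an order-preserving monoid morphism between $\mathrm{Cu}$-semigroups that preserves suprema of increasing sequences and the way-below relation. A submonoid $T\subseteq S$ is a sub-$\mathrm{Cu}$-semigroup if $T$ is a $\mathrm{Cu}$-semigroup with respect to the order induced by $S$ and the inclusion map $T\to S$ is a $\mathrm{Cu}$-morphism. A subset $B\subseteq S$ is a basis if for all $x'\ll x$ in $S$ there exists $y\in B$ with $x'\ll y\ll x$; $S$ is countably based if it has a countable basis. Additional properties of a $\mathrm{Cu}$-semigroup: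 (O5) given $x+y\leq z$, $x'\ll x$ and $y'\ll y$, there exists $c$ such that $x'+c\leq z\leq x+c$ and $y'\ll c$. (O6) given $x'\ll x\leq y+z$ there exist $v\leq x,y$ and $w\leq x,z$ (i.e. $v\leq x$, $v\leq y$, $w\leq x$, $w\leq z$) such that $x'\leq v+w$. (O7) given $x_1'\ll x_1\leq w$ and $x_2'\ll x_2\leq w$ there exists $x$ such that $x_1'\ll x$, $x_2'\ll x$, $x\leq w$ and $x\leq x_1+x_2$. $\mathrm{Sub}_{\mathrm{ctbl}}(S)$ is the collection of countably based sub-$\mathrm{Cu}$-semigroups of $S$. For a subset $T\subseteq S$, its sup-closure $\overline{T}^{\mathrm{sup}}$ is the smallest subset of $S$ that contains $T$ and is closed under suprema of increasing sequences. If $\mathcal{T}\subseteq\mathrm{Sub}_{\mathrm{ctbl}}(S)$ is countable and (upward) directed, then $\overline{\bigcup\mathcal{T}}^{\mathrm{sup}}\in\mathrm{Sub}_{\mathrm{ctbl}}(S)$. A collection $\mathcal{R}\subseteq\mathrm{Sub}_{\mathrm{ctbl}}(S)$ is $\sigma$-complete if $\overline{\bigcup\mathcal{T}}^{\mathrm{sup}}\in\mathcal{R}$ for every countable, directed subset $\mathcal{T}\subseteq\mathcal{R}$; it is cofinal if for every $T_0\in\mathrm{Sub}_{\mathrm{ctbl}}(S)$ there is $T\in\mathcal{R}$ with $T_0\subseteq T$. A property $\mathcal{P}$ of $\mathrm{Cu}$-semigroups satisfies the L\''owenheim-Skolem condition if for every $\mathrm{Cu}$-semigroup $S$ satisfying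 $\mathcal{P}$ there exists a $\sigma$-complete, cofinal subcollection $\mathcal{R}\subseteq\mathrm{Sub}_{\mathrm{ctbl}}(S)$ such that every $R\in\mathcal{R}$ satisfies $\mathcal{P}$. *)

(* Defs.v *)
From HB Require Import structures.
From mathcomp Require Import all_boot all_order all_algebra.
From mathcomp Require Import boolp classical_sets functions cardinality.

Set Implicit Arguments.
Unset Strict Implicit.
Unset Printing Implicit Defensive.

Import Order.TTheory GRing.Theory.
Local Open Scope classical_set_scope.
Local Open Scope ring_scope.

(* As usual for Cu-semigroups, increasing means nondecreasing. *)
Definition increasing_seq d (S : porderType d) (z : nat -> S) : Prop :=
  {homo z : m n / (m <= n)%N >-> (m <= n)%O}.

Definition is_seq_sup d (S : porderType d) (z : nat -> S) (s : S) : Prop :=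
  isLub (range z) s.

(* x << y; sequences without a supremum are not tested. *)
Definition way_below d (S : porderType d) (x y : S) : Prop :=
  forall (z : nat -> S) (s : S), increasing_seq z -> is_seq_sup z s ->
    (y <= s)%O -> exists n, (x <= z n)%O.

(* The order is a field rather than a separate POrder class because a structure
   joining POrder and Nmodule cannot be declared once ssrnum's POrderedZmodule
   exists; the porderType structure is derived right below. *)
HB.mixin Record Nmodule_isPOM S of GRing.Nmodule S := {
  pom_le : rel S;
  pom_le_refl : reflexive pom_le;
  pom_le_anti : antisymmetric pom_le;
  pom_le_trans : transitive pom_le;
  pom_le0x : forall x : S, pom_le 0 x;
  pom_leD2r : forall z x y : S, pom_le x y -> pom_le (x + z) (y + z)
}.

(* Positively ordered abelian monoids. *)
#[short(type="pomType")]
HB.structure Definition POM := { S of GRing.Nmodule S & Nmodule_isPOM S }.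

HB.instance Definition _ (S : pomType) :=
  Order.Le_isPOrder.Build ring_display (POM.sort S)
    (@pom_le_refl S) (@pom_le_anti S) (@pom_le_trans S).

Record Cu_axioms (S : pomType) : Prop := {
  Cu_O1 : forall z : nat -> S, increasing_seq z -> exists s, is_seq_sup z s;
  Cu_O2 : forall x : S, exists z : nat -> S,
    (forall n, way_below (z n) (z n.+1)) /\ is_seq_sup z x;
  Cu_O3 : forall x' x y' y : S,
    way_below x' x -> way_below y' y -> way_below (x' + y') (x + y);
  Cu_O4 : forall (x y : nat -> S) (a b : S),
    increasing_seq x -> increasing_seq y -> is_seq_sup x a -> is_seq_sup y b ->
    is_seq_sup (fun n => x n + y n) (a + b)
}.

Record cuType := CuType {
  cu_pom :> pomType;
  cu_axioms : Cu_axioms cu_pom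
}.

Record is_Cu_morphism (S T : cuType) (f : S -> T) : Prop := {
  Cu_mor_nmod : GRing.nmod_morphism f;
  Cu_mor_le : {homo f : x y / x <= y};
  Cu_mor_sup : forall (z : nat -> S) (s : S),
    increasing_seq z -> is_seq_sup z s -> is_seq_sup (f \o z) (f s);
  Cu_mor_wb : forall x y : S, way_below x y -> way_below (f x) (f y)
}.

Definition is_basis (S : cuType) (B : set S) : Prop :=
  forall x' x : S, way_below x' x ->
    exists y, [/\ B y, way_below x' y & way_below y x].

Definition countably_based (S : cuType) : Prop :=
  exists B : set S, countable B /\ is_basis B.

Definition O5 (S : cuType) : Prop :=
  forall x' x y' y z : S,
    x + y <= z -> way_below x' x -> way_below y' y ->
    exists c, [/\ x' + c <= z, z <= x + c & way_below y' c].

Definition O6 (S : cuType) : Prop :=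
  forall x' x y z : S, way_below x' x -> x <= y + z ->
    exists v w, [/\ v <= x, v <= y, w <= x, w <= z & x' <= v + w].

Definition O7 (S : cuType) : Prop :=
  forall x1' x1 x2' x2 w : S,
    way_below x1' x1 -> x1 <= w -> way_below x2' x2 -> x2 <= w ->
    exists x, [/\ way_below x1' x, way_below x2' x, x <= w & x <= x1 + x2].

(* A submonoid T of S, as a type carrying the operations and order of S. *)
Definition sub_pom (S : pomType) (T : set S)
  (Tmon : GRing.nmod_closed [in T]) : Type :=
  {x : S | x \in T}.

Section SubPOM.
Variables (S : pomType) (T : set S) (Tmon : GRing.nmod_closed [in T]).

HB.instance Definition _ := SubChoice.on (sub_pom Tmon).
HB.instance Definition _ :=
  GRing.SubChoice_isSubNmodule.Build S [in T] (sub_pom Tmon) Tmon.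

Definition sub_pom_le (x y : sub_pom Tmon) : bool := \val x <= \val y.

Lemma sub_pom_le_refl : reflexive sub_pom_le.
Proof. by move=> x; apply: lexx. Qed.

Lemma sub_pom_le_anti : antisymmetric sub_pom_le.
Proof. by move=> x y xy; apply/val_inj/le_anti. Qed.

Lemma sub_pom_le_trans : transitive sub_pom_le.
Proof. by move=> y x z; apply: le_trans. Qed.

Lemma sub_pom_le0x (x : sub_pom Tmon) : sub_pom_le 0 x.
Proof. by rewrite /sub_pom_le raddf0; apply: pom_le0x. Qed.

Lemma sub_pom_leD2r (z x y : sub_pom Tmon) :
  sub_pom_le x y -> sub_pom_le (x + z) (y + z).
Proof. by rewrite /sub_pom_le !raddfD; apply: pom_leD2r. Qed.

HB.instance Definition _ := Nmodule_isPOM.Build (sub_pom Tmon)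
  sub_pom_le_refl sub_pom_le_anti sub_pom_le_trans
  sub_pom_le0x sub_pom_leD2r.
End SubPOM.

(* The proof fields are irrelevant: a sub-Cu-semigroup is determined by
   its carrier. *)
Record subCu (S : cuType) := SubCu {
  carrier : set S;
  subCu_mon : GRing.nmod_closed [in carrier];
  subCu_Cu : Cu_axioms (sub_pom subCu_mon);
  subCu_incl : @is_Cu_morphism (CuType subCu_Cu) S
    (fun x : sub_pom subCu_mon => \val x)
}.

Definition Cu_of_subCu (S : cuType) (T : subCu S) : cuType :=
  CuType (subCu_Cu T).
Coercion Cu_of_subCu : subCu >-> cuType.

Definition Sub_ctbl (S : cuType) : set (subCu S) :=
  [set T : subCu S | countably_based T].

Definition sup_closed (S : cuType) (A : set S) : Prop :=
  forall (z : nat -> S) (s : S), increasing_seq z -> (forall n, A (z n)) ->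
    is_seq_sup z s -> A s.

Definition sup_closure (S : cuType) (A : set S) : set S :=
  smallest (@sup_closed S) A.

(* Nonempty, since the sup-closure of the empty union is not a submonoid. *)
Definition directed (S : cuType) (TT : set (subCu S)) : Prop :=
  TT !=set0 /\
  forall T1 T2, TT T1 -> TT T2 -> exists T3,
    [/\ TT T3, carrier T1 `<=` carrier T3 & carrier T2 `<=` carrier T3].

Definition sigma_complete (S : cuType) (RR : set (subCu S)) : Prop :=
  forall TT : set (subCu S), TT `<=` RR -> countable TT -> directed TT ->
    exists2 R, RR R & carrier R = sup_closure (\bigcup_(T in TT) carrier T).

Definition cofinal (S : cuType) (RR : set (subCu S)) : Prop :=
  forall T0, Sub_ctbl T0 -> exists2 T, RR T & carrier T0 `<=` carrier T.

Definition Lowenheim_Skolem (P : cuType -> Prop) : Prop :=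
  forall S : cuType, P S -> exists RR : set (subCu S),
    [/\ RR `<=` @Sub_ctbl S, sigma_complete RR, cofinal RR &
        forall R, RR R -> P R].

(* Main.v *)
Require Import Defs.
From mathcomp Require Import all_boot all_order all_algebra.
From mathcomp Require Import boolp classical_sets functions cardinality.

Set Implicit Arguments.
Unset Strict Implicit.
Unset Printing Implicit Defensive.

Import Order.TTheory GRing.Theory.
Local Open Scope classical_set_scope.
Local Open Scope ring_scope.

(**
Throughout, subsets U of a Cu-semigroup S replace sub-Cu-semigroups.  Say that
x is based on U if every x' << x can be separated from x by an element of U:
x' << b << x for some b in U.  Equivalently, x is the supremum of a
<<-increasing sequence in U.  If U is a submonoid whose elements are all based
on U, then the set of elements based on U is a sub-Cu-semigroup with the same
suprema and the same way-below relation as S ([based_on_subCu]), it is the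
sup-closure of U ([based_onE]), and a countable U makes it countably based.
Every sub-Cu-semigroup arises like this from its carrier.

Each of (O5), (O6), (O7) has the form: finitely many elements related in some
way have finitely many witnesses.  Hence there is an evident version of it
relative to a subset U, where both the given elements and the witnesses range
over U; call it Q(U).  Three facts give the result.

- Q(U) implies Q(based_on U).  For (O6) and (O7) the given elements are
  approximated by elements of U and the witnesses found in U are already good
  enough.  For (O5) the witness c has to satisfy z <= x + c for a z that is only
  a supremum of elements of U, and it is built as the supremum of a
  <<-increasing sequence in U of better and better witnesses ([O5_based_on]).

- Q passes to directed unions, since finitely many elements of the union lie in
  one member and the witnesses are found there.  With the first fact, applied to
  the union of the family, this gives sigma-completeness.

- If S has the property, any countable subset lies in a countable submonoid U
  with U contained in based_on U and Q(U): close it off under sums, under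
  a choice of <<-increasing sequences, and under a choice of witnesses
  ([countable_reflecting_hull]).  Applied to a countable basis of a given
  sub-Cu-semigroup, this gives cofinality.
*)

(** * The way-below relation *)

Section WayBelow.
Context {d : Order.disp_t} {P : porderType d}.
Implicit Types (x y s : P) (z : nat -> P).

Lemma seq_sup_ub z s n : is_seq_sup z s -> (z n <= s)%O.
Proof. by case=> ub _; apply: ub; exists n. Qed.

Lemma seq_sup_le z s y : is_seq_sup z s -> (forall n, z n <= y)%O -> (s <= y)%O.
Proof. by case=> _ lub zy; apply: lub => _ [n _ <-]. Qed.

Lemma seq_sup_cst x : is_seq_sup (fun=> x) x.
Proof.
by split=> [_ [_ _ <-] //|y uby]; apply: uby; exists 0%N.
Qed.

Lemma way_below_le x y : way_below x y -> (x <= y)%O.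
Proof.
move=> xy; have [] // := xy (fun=> y) y _ (seq_sup_cst y) (lexx y).
Qed.

Lemma le_way_below y x x' : (x' <= x)%O -> way_below x y -> way_below x' y.
Proof.
move=> le_x'x xy z s zi zs ys; have [n xz] := xy z s zi zs ys.
by exists n; apply: le_trans xz.
Qed.

Lemma way_below_le_trans y x y' :
  way_below x y -> (y <= y')%O -> way_below x y'.
Proof. by move=> xy le_yy' z s zi zs y's; apply: xy (le_trans le_yy' y's). Qed.

Lemma way_below_trans y x w : way_below x y -> way_below y w -> way_below x w.
Proof. by move=> /way_below_le; apply: le_way_below. Qed.

Lemma way_below_increasing z :
  (forall n, way_below (z n) (z n.+1)) -> increasing_seq z.
Proof.
move=> zW; apply: homo_leq => [x|y x w|n]; [exact: lexx|exact: le_trans|].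
exact: way_below_le.
Qed.

Lemma seq_sup_way_below z s n :
  (forall n, way_below (z n) (z n.+1)) -> is_seq_sup z s -> way_below (z n) s.
Proof.
by move=> zW zs; apply: way_below_le_trans (zW n) (seq_sup_ub _ zs).
Qed.

End WayBelow.

Section POMTheory.
Variable S : pomType.
Implicit Types (x y : S).

Lemma pom_ge0 x : (0 : S) <= x. Proof. exact: pom_le0x. Qed.

Lemma pom_leD x y x' y' : x <= x' -> y <= y' -> x + y <= x' + y'.
Proof.
move=> xx' yy'; apply: (le_trans (pom_leD2r y _ _ xx')).
by rewrite ![x' + _]addrC; apply: pom_leD2r.
Qed.

End POMTheory.

Section CuTheory.
Variable S : cuType.
Implicit Types (x y : S) (z : nat -> S) (U V : set S).

Lemma way_below0 : way_below (0 : S) 0.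
Proof. by move=> z s _ _ _; exists 0%N; apply: pom_ge0. Qed.

Lemma seq_supDl x z s : increasing_seq z -> is_seq_sup z s ->
  is_seq_sup (fun n => x + z n) (x + s).
Proof.
by move=> zi zs; apply: Cu_O4 zs; first exact: cu_axioms;
  [move=> *; apply: lexx|move=> *; apply: zi|exact: seq_sup_cst].
Qed.

Lemma increasing_seqDl x z :
  increasing_seq z -> increasing_seq (fun n => x + z n).
Proof. by move=> zi m n mn; apply: pom_leD; rewrite ?lexx ?zi. Qed.

Lemma way_below_interpolation x y :
  way_below x y -> exists2 w, way_below x w & way_below w y.
Proof.
move=> xy; have [z [zW zs]] := Cu_O2 (cu_axioms S) y.
have [n xz] := xy z y (way_below_increasing zW) zs (lexx _).
by exists (z n.+1); [apply: le_way_below xz _|apply: seq_sup_way_below].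
Qed.

(** * Sets approximating their elements *)

(** Letting x' range over all of S makes this set closed under suprema of
    increasing sequences for every U. *)
Definition based_on U : set S :=
  [set x | forall x', way_below x' x ->
     exists b, [/\ U b, way_below x' b & way_below b x]].

Lemma based_on_subset U V : U `<=` V -> based_on U `<=` based_on V.
Proof.
by move=> UV x xU x' /xU[b [/UV]]; exists b.
Qed.

Lemma based_on_bind U V : U `<=` based_on V -> based_on U `<=` based_on V.
Proof.
move=> UV x xU x' /xU[u [/UV uV x'u ux]]; have [b [Vb x'b bu]] := uV _ x'u.
by exists b; split=> //; apply: way_below_trans ux.
Qed.

Lemma seq_sup_based_on U z x : (forall n, U (z n)) ->
  (forall n, way_below (z n) (z n.+1)) -> is_seq_sup z x -> based_on U x.
Proof.
move=> Uz zW zs x' /way_below_interpolation[w x'w wx].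
have [n wz] := wx z x (way_below_increasing zW) zs (lexx _).
exists (z n); split=> //; last exact: seq_sup_way_below.
exact: way_below_le_trans wz.
Qed.

(** Take a <<-increasing sequence y in S with supremum x and b n in U between
    y n and x.  As b n << x, it lies below a later y m, hence way below b m.+1;
    iterating this passage thins b out to a <<-increasing sequence. *)
Lemma based_on_seq_sup U x : based_on U x ->
  exists z, [/\ forall n, U (z n), forall n, way_below (z n) (z n.+1)
              & is_seq_sup z x].
Proof.
move=> xU; have [y [yW ys]] := Cu_O2 (cu_axioms S) x.
have yi := way_below_increasing yW.
have /choice[b bP] n : exists b, [/\ U b, way_below (y n) b & way_below b x].
  by apply: xU; apply: seq_sup_way_below.
have /choice[f fP] n : exists m, (n <= m)%N /\ b n <= y m.
  have [_ _ bx] := bP n; have [m bm] := bx y x yi ys (lexx _).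
  exists (maxn n m); split; first exact: leq_maxl.
  by apply: le_trans bm (yi _ _ (leq_maxr _ _)).
have le_f n : (n <= iter n (fun m => (f m).+1) 0)%N.
  elim: n => // n IH; rewrite iterS ltnS; apply: leq_trans IH _.
  exact: (fP _).1.
exists (fun n => b (iter n (fun m => (f m).+1) 0%N)); split=> [n|n|].
- by have [] := bP (iter n (fun m => (f m).+1) 0%N).
- rewrite iterS; set m := iter _ _ _.
  have [_ _ _] := bP m; have [_ bWy _] := bP (f m).+1.
  apply: le_way_below bWy; apply: le_trans (fP m).2 _.
  exact: way_below_le.
- split=> [_ [n _ <-]|w wub].
    by apply: way_below_le; have [] := bP (iter n (fun m => (f m).+1) 0%N).
  apply: (seq_sup_le ys) => n; apply: le_trans (yi _ _ (le_f n)) _.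
  have [_ /way_below_le yb _] := bP (iter n (fun m => (f m).+1) 0%N).
  by apply: le_trans yb (wub _ _); exists n.
Qed.

(** Both bounds on the interpolated b already hold at some stage of the
    sequence. *)
Lemma sup_closed_based_on U : sup_closed (based_on U).
Proof.
move=> z s zi zU zs x' /way_below_interpolation[w x'w ws].
have [n wz] := ws z s zi zs (lexx _).
have [b [Ub x'b bz]] := zU n x' (way_below_le_trans x'w wz).
by exists b; split=> //; apply: way_below_le_trans bz (seq_sup_ub _ zs).
Qed.

Lemma based_on_sup_closed U V : U `<=` V -> sup_closed V -> based_on U `<=` V.
Proof.
move=> UV Vs x /based_on_seq_sup[z [zU zW zs]].
by apply: Vs zs => [|n]; [apply: way_below_increasing|apply: UV].
Qed.

Lemma based_onE U : U `<=` based_on U -> based_on U = sup_closure U.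
Proof.
move=> UU; apply/seteqP; split.
  apply: based_on_sup_closed; first exact: sub_smallest.
  move=> z s zi zU zs V VP; have [Vs _] := VP.
  by apply: Vs zs => // n; apply: zU VP.
by apply: smallest_sub => //; apply: sup_closed_based_on.
Qed.

Lemma based_on0 U : U 0 -> based_on U 0.
Proof.
move=> U0 x' x'0; exists 0; split=> //; exact: way_below0.
Qed.

Lemma based_onD U : (forall x y, U x -> U y -> U (x + y)) ->
  forall x y, based_on U x -> based_on U y -> based_on U (x + y).
Proof.
move=> UD x y /based_on_seq_sup[a [aU aW ax]] /based_on_seq_sup[b [bU bW bx]].
apply: (@seq_sup_based_on _ (fun n => a n + b n)) => [n|n|].
- exact: UD.
- by apply: Cu_O3 => //; apply: cu_axioms.
- by apply: Cu_O4 => //; [apply: cu_axioms|apply: way_below_increasing..].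
Qed.

Lemma based_on_directed U x y w : based_on U w ->
  way_below x w -> way_below y w ->
  exists u, [/\ U u, way_below x u, way_below y u & way_below u w].
Proof.
move=> /based_on_seq_sup[z [zU zW zs]] xw yw.
have zi := way_below_increasing zW.
have [m xm] := xw z w zi zs (lexx _); have [n yn] := yw z w zi zs (lexx _).
exists (z (maxn m n).+1); split=> //; last exact: seq_sup_way_below.
- by apply: le_way_below (zW _); apply: le_trans xm (zi _ _ (leq_maxl _ _)).
- by apply: le_way_below (zW _); apply: le_trans yn (zi _ _ (leq_maxr _ _)).
Qed.

Lemma based_onD_below U b y w : based_on U y -> based_on U w ->
  way_below b (y + w) ->
  exists y1 w1, [/\ U y1, U w1, way_below y1 y, way_below w1 w & b <= y1 + w1].
Proof.
move=> /based_on_seq_sup[p [pU pW py]] /based_on_seq_sup[q [qU qW qw]] byw.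
have pi := way_below_increasing pW; have qi := way_below_increasing qW.
have [|||n bn] := byw (fun n => p n + q n) (y + w).
- by move=> m n mn; apply: pom_leD; [apply: pi|apply: qi].
- by apply: Cu_O4 => //; apply: cu_axioms.
- exact: lexx.
by exists (p n), (q n); split=> //; apply: seq_sup_way_below.
Qed.

End CuTheory.

(** * Sub-Cu-semigroups as subsets *)

(** Only two properties of a submonoid T matter: it is closed under suprema of
    increasing sequences, and each of its elements is approximated from within
    T.  The first makes suprema in T and in S agree; with the second, so do the
    two way-below relations, and the axioms of S are inherited by T. *)
Section SubPOM.
Variables (S : cuType) (T : set S) (Tmon : GRing.nmod_closed [in T]).
Local Notation subT := (sub_pom Tmon : pomType).
Hypothesis Tsup : sup_closed T.
Implicit Types (x y : subT) (z : nat -> subT).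

Lemma sub_pom_in x : T (\val x).
Proof. by have := valP x; rewrite inE. Qed.

Definition to_sub_pom (x : S) (Tx : T x) : subT :=
  exist _ x (mem_set Tx).

Lemma increasing_seq_val z :
  increasing_seq (fun n => \val (z n)) <-> increasing_seq z.
Proof. by []. Qed.

Lemma sub_pom_seq_sup z x : increasing_seq z ->
  is_seq_sup z x <-> is_seq_sup (fun n => \val (z n)) (\val x).
Proof.
move=> zi.
have [s sP] := Cu_O1 (cu_axioms S) ((increasing_seq_val z).2 zi).
have Ts : T s by apply: Tsup sP => // n; apply: sub_pom_in.
split=> [zx|zx].
- suff -> : \val x = s by [].
  apply/le_anti/andP; split.
  + apply: (@seq_sup_le _ _ z x (to_sub_pom Ts) zx) => n.
    exact: (seq_sup_ub n sP).
  + by apply: (seq_sup_le sP) => n; apply: (seq_sup_ub n zx).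
- split=> [_ [n _ <-]|y yub]; first exact: (seq_sup_ub n zx).
  by apply: (seq_sup_le zx (y := \val y)) => n; apply: yub; exists n.
Qed.

Hypothesis Tbased : T `<=` based_on T.

(** From T to S: y is the supremum of a <<-increasing sequence in T, and the
    condition in T, tested on that sequence alone, puts x below one of its
    terms. *)
Lemma sub_pom_way_below x y : way_below x y <-> way_below (\val x) (\val y).
Proof.
split=> [xy|xy z s zi /sub_pom_seq_sup zs ys]; last first.
  exact: xy zi (zs zi) ys.
have [z [zT zW zs]] := based_on_seq_sup (Tbased (sub_pom_in y)).
have zi := way_below_increasing zW.
pose w n := to_sub_pom (zT n).
have wy : is_seq_sup w y by apply/sub_pom_seq_sup.
have [n xz] := xy w y zi wy (lexx _).
apply: (@le_way_below _ _ _ (z n)); first exact: xz.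
exact: seq_sup_way_below.
Qed.

Lemma sub_pom_Cu_axioms : Cu_axioms subT.
Proof.
have cuS := cu_axioms S; split.
- move=> z zi; have [s sP] := Cu_O1 cuS ((increasing_seq_val z).2 zi).
  have Ts : T s by apply: Tsup sP => // n; apply: sub_pom_in.
  by exists (to_sub_pom Ts); apply/sub_pom_seq_sup.
- move=> x; have [z [zT zW zs]] := based_on_seq_sup (Tbased (sub_pom_in x)).
  exists (fun n => to_sub_pom (zT n)); split=> [n|].
    by apply/sub_pom_way_below; apply: zW.
  by apply/sub_pom_seq_sup; first exact: (way_below_increasing zW).
- move=> x' x y' y /sub_pom_way_below xx /sub_pom_way_below yy.
  by apply/sub_pom_way_below; rewrite !raddfD; apply: Cu_O3.
- move=> x y a b xi yi /sub_pom_seq_sup xa /sub_pom_seq_sup yb.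
  apply/sub_pom_seq_sup.
    by move=> m n mn; apply: pom_leD; [apply: xi|apply: yi].
  rewrite raddfD /=; exact: (Cu_O4 cuS _ _ (xa xi) (yb yi)).
Qed.

Lemma sub_pom_val_morphism :
  @is_Cu_morphism (CuType sub_pom_Cu_axioms) S (fun x : subT => \val x).
Proof.
split=> //.
- by move=> z s zi /sub_pom_seq_sup; apply.
- by move=> x y /sub_pom_way_below.
Qed.

End SubPOM.

Section SubCu.
Variable S : cuType.

Lemma based_on_subCu (U : set S) :
  U 0 -> (forall x y, U x -> U y -> U (x + y)) -> U `<=` based_on U ->
  exists T : subCu S, carrier T = based_on U.
Proof.
move=> U0 UD UU.
have mon : GRing.nmod_closed [in based_on U].
  split; first by rewrite inE; apply: based_on0.
  by move=> x y; rewrite !inE; apply: based_onD.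
have TT : based_on U `<=` based_on (based_on U) by apply: based_on_subset.
by exists (SubCu (sub_pom_val_morphism mon (@sup_closed_based_on _ _) TT)).
Qed.

Variable T : subCu S.
Implicit Types (x y : T).

Lemma carrier_in x : carrier T (\val x).
Proof. exact: sub_pom_in. Qed.

Lemma carrier0 : carrier T 0.
Proof. by have [] := subCu_mon T; rewrite inE. Qed.

Lemma carrierD (x y : S) : carrier T x -> carrier T y -> carrier T (x + y).
Proof. by have [_ /(_ x y)] := subCu_mon T; rewrite !inE. Qed.

Lemma sup_closed_carrier : sup_closed (carrier T).
Proof.
move=> z s zi zT zs.
pose w n : T := to_sub_pom (subCu_mon T) (zT n).
have [t wt] := Cu_O1 (subCu_Cu T) (zi : increasing_seq w).
suff -> : s = \val t by apply: carrier_in.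
have zt : is_seq_sup z (\val t)
  := Cu_mor_sup (subCu_incl T) (zi : increasing_seq w) wt.
apply/le_anti/andP; split.
- by apply: (seq_sup_le zs) => n; apply: seq_sup_ub zt.
- by apply: (seq_sup_le zt) => n; apply: seq_sup_ub zs.
Qed.

Lemma carrier_based : carrier T `<=` based_on (carrier T).
Proof.
move=> x Tx; pose t : T := to_sub_pom (subCu_mon T) Tx.
have [z [zW zs]] := Cu_O2 (subCu_Cu T) t.
apply: (@seq_sup_based_on _ _ (fun n => \val (z n))) => [n|n|].
- exact: carrier_in.
- exact: (Cu_mor_wb (subCu_incl T)).
- exact: (Cu_mor_sup (subCu_incl T) (way_below_increasing zW) zs).
Qed.

Lemma carrier_way_below x y : way_below x y <-> way_below (\val x) (\val y).
Proof. exact: sub_pom_way_below sup_closed_carrier carrier_based _ _. Qed.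

(** A basis of T need only separate pairs x' << x with x' in T.  It also does so
    when x' is any element of S, since a term of a sequence in T with supremum x
    fits between x' and x. *)
Lemma countably_basedP : countably_based T <->
  exists B : set S,
    [/\ countable B, B `<=` carrier T & carrier T `<=` based_on B].
Proof.
split=> [[B [ctB Bb]]|[B [ctB BT TB]]].
- exists ((fun x : T => \val x) @` B); split.
  + exact: sub_countable (card_image_le _ _) ctB.
  + by move=> _ [x _ <-]; apply: carrier_in.
  + move=> x Tx; have [z [zT zW zs]] := based_on_seq_sup (carrier_based Tx).
    move=> x' x'x.
    have [n x'z] := x'x z x (way_below_increasing zW) zs (lexx _).
    pose t n : T := to_sub_pom (subCu_mon T) (zT n).
    have tW : way_below (t n) (t n.+1) by apply/carrier_way_below; apply: zW.
    have [b [Bb' /carrier_way_below zb /carrier_way_below bz]] := Bb _ _ tW.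
    exists (\val b); split; first by exists b.
      exact: le_way_below x'z zb.
    exact: way_below_trans bz (seq_sup_way_below _ zW zs).
- exists ((fun x : T => \val x) @^-1` B); split.
    have /countable_injP[f fi] := ctB; apply/countable_injP.
    exists (fun x : T => f (\val x)) => x y; rewrite !inE => Bx By fxy.
    by apply/val_inj/fi; rewrite ?inE.
  move=> x' x /carrier_way_below x'x.
  have [b [Bb x'b bx]] := TB _ (carrier_in x) _ x'x.
  exists (to_sub_pom (subCu_mon T) (BT _ Bb)).
  by split=> //; apply/carrier_way_below.
Qed.

End SubCu.

(** * Countable hulls *)

Lemma set_seq_cons (V : eqType) (x : V) (l : seq V) (U : set V) :
  [set` x :: l] `<=` U <-> U x /\ [set` l] `<=` U.
Proof.
split=> [sU|[Ux lU] y /=].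
  by split=> [|y yl]; apply: sU; rewrite /= inE ?eqxx ?yl ?orbT.
by rewrite inE => /orP[/eqP->|/lU].
Qed.

Lemma countableU2 (V : Type) (A B : set V) :
  countable A -> countable B -> countable (A `|` B).
Proof.
by move=> cA cB; rewrite -bigcup2inE; apply: bigcup_countable => // [[|[|]]].
Qed.

Lemma countable_range (V : Type) (I : countType) (f : I -> V) :
  countable (range f).
Proof. by apply: sub_countable (card_image_le _ _) _. Qed.

Lemma countable_enum (V : Type) (x0 : V) (A : set V) : countable A ->
  exists e : nat -> V, A `<=` range e.
Proof.
move=> /pfcard_geP[->|[f]]; first by exists (fun=> x0).
by exists f => x Ax; have [n _ <-] := 'surj_f Ax; exists n.
Qed.

Section Hull.
Variables (V : choiceType) (x0 : V).

(** Trees are formal terms: a leaf is a generator, and node n names the n-th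
    value of the operation on the list of subtrees. *)
Fixpoint eval_tree (leaf : nat -> V) (node : seq V -> nat -> V)
    (t : GenTree.tree nat) : V :=
  match t with
  | GenTree.Leaf n => leaf n
  | GenTree.Node n ts => node (map (eval_tree leaf node) ts) n
  end.

(** The hull is the set of values of the formal terms, and there are countably
    many of these. *)
Lemma countable_hull (F : seq V -> set V) (A : set V) :
  (forall l, countable (F l)) -> countable A ->
  exists B,
    [/\ countable B, A `<=` B & forall l, [set` l] `<=` B -> F l `<=` B].
Proof.
move=> cF /(countable_enum x0)[leaf leafP].
have /choice[node nodeP] l := countable_enum x0 (cF l).
exists (range (eval_tree leaf node)); split.
- exact: countable_range.
- by move=> x /leafP[n _ <-]; exists (GenTree.Leaf n).
- move=> l lB x /nodeP[n _ <-].
  suff [ts <-] : exists ts, map (eval_tree leaf node) ts = l.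
    by exists (GenTree.Node n ts).
  elim: l lB => [|y l IH]; first by exists [::].
  by move=> /set_seq_cons[[t _ <-] /IH[ts <-]]; exists (t :: ts).
Qed.

End Hull.

(** * Finitary properties *)

(** H l says that the elements l satisfy the hypotheses of a property, and C l r
    that the elements r are witnesses of its conclusion for l. *)
Definition witnessed_in (V : eqType) (H : seq V -> Prop)
    (C : seq V -> seq V -> Prop) (U : set V) : Prop :=
  forall l, [set` l] `<=` U -> H l -> exists r, [set` r] `<=` U /\ C l r.

(** Properties of this form pass to nonempty directed unions, and can be enforced
    by countably many closure steps. *)
Definition finitary (V : eqType) (Q : set V -> Prop) : Prop :=
  exists H C, forall U, Q U <-> witnessed_in H C U.

Section Reflection.
Variables (S : cuType) (Q : set S -> Prop).
Hypothesis Qfin : finitary Q.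

(** The Loewenheim-Skolem step; Skolem functions are chosen once in S and the
    given set is closed off under them. *)
Lemma countable_reflecting_hull (A : set S) : Q setT -> countable A ->
  exists B, [/\ countable B /\ A `<=` B, B 0,
    forall x y, B x -> B y -> B (x + y), B `<=` based_on B & Q B].
Proof.
move=> QT cA; have [H [C QP]] := Qfin; move/QP: QT => HC.
have /choice[wit witP] (l : seq S) : exists r, H l -> C l r.
  have [Hl|nHl] := pselect (H l); last by exists [::].
  by have [|r [_ Cr]] := HC l _ Hl; [|exists r].
have /choice[apx apxP] := Cu_O2 (cu_axioms S).
(* The empty list contributes 0, through the empty sum. *)
pose F (l : seq S) : set S :=
  [set \sum_(x <- l) x] `|` (range (apx (head 0 l)) `|` [set` wit l]).
have [|B [cB AB FB]] := @countable_hull _ (0 : S) F A _ cA.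
  move=> l; apply: countableU2; first exact: countable1.
  apply: countableU2; first exact: countable_range.
  exact/finite_set_countable/finite_seq.
exists B; split=> //.
- by apply: (FB [::]) => //; left; rewrite /= big_nil.
- move=> x y Bx By; apply: (FB [:: x; y]).
    by do 2?[apply/set_seq_cons; split].
  by left; rewrite /= big_cons big_seq1.
- move=> x Bx; have [zW zs] := apxP x.
  apply: seq_sup_based_on zW zs => n.
  apply: (FB [:: x]); first by apply/set_seq_cons.
  by right; left; exists n.
- apply/QP => l lB Hl; exists (wit l); split; last exact: witP.
  by move=> x xl; apply: (FB l) => //; right; right.
Qed.

Lemma directed_seq (TT : set (subCu S)) (l : seq S) : directed TT ->
  [set` l] `<=` \bigcup_(T in TT) carrier T ->
  exists2 T, TT T & [set` l] `<=` carrier T.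
Proof.
move=> [[T0 TT0] TTd]; elim: l => [_|x l IH]; first by exists T0.
move=> /set_seq_cons[[T1 TT1 xT1] /IH[T2 TT2 lT2]].
have [T3 [TT3 T13 T23]] := TTd _ _ TT1 TT2.
exists T3 => //; apply/set_seq_cons; split; first exact: T13.
exact: subset_trans T23.
Qed.

Variable P : cuType -> Prop.
Hypothesis PQ : forall T : subCu S, P T <-> Q (carrier T).
Hypothesis Q_based_on :
  forall U : set S, U `<=` based_on U -> Q U -> Q (based_on U).

Lemma reflected_sigma_complete :
  sigma_complete [set T : subCu S | Sub_ctbl T /\ P T].
Proof.
move=> TT TTP cTT dTT; set U := \bigcup_(T in TT) carrier T.
have U2 x y : U x -> U y -> exists2 T, TT T & carrier T x /\ carrier T y.
  move=> Ux Uy; have [|T TTT] := directed_seq dTT (l := [:: x; y]).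
    by do 2?[apply/set_seq_cons; split].
  by move=> /set_seq_cons[Tx /set_seq_cons[Ty _]]; exists T.
have U0 : U 0 by have [[T TTT] _] := dTT; exists T => //; apply: carrier0.
have UD x y : U x -> U y -> U (x + y).
  move=> Ux Uy; have [T TTT [Tx Ty]] := U2 x y Ux Uy.
  by exists T => //; apply: carrierD.
have UU : U `<=` based_on U.
  move=> x [T TTT /carrier_based]; apply: based_on_subset => y Ty.
  by exists T.
have QU : Q U.
  have [H [C QP]] := Qfin; apply/QP.
  move=> l /(directed_seq dTT)[T TTT lT] Hl.
  have [_ /PQ/QP HT] := TTP _ TTT.
  have [r [rT Cr]] := HT l lT Hl.
  by exists r; split=> // x /rT; exists T.
have [R RE] := based_on_subCu U0 UD UU.
exists R; last by rewrite RE; apply: based_onE.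
split; last by apply/PQ; rewrite RE; apply: Q_based_on.
have /choice[B BP] (T : subCu S) : exists B, TT T ->
    [/\ countable B, B `<=` carrier T & carrier T `<=` based_on B].
  have [TTT|nT] := pselect (TT T); last by exists set0.
  by have [/countably_basedP[B ?] _] := TTP _ TTT; exists B.
apply/countably_basedP; exists (\bigcup_(T in TT) B T); rewrite RE; split.
- by apply: bigcup_countable => // T TTT; have [] := BP T TTT.
- move=> x [T TTT Bx]; apply: UU; exists T => //.
  by have [_ BT _] := BP T TTT; apply: BT.
- apply: based_on_bind => x [T TTT Tx].
  have [_ _ TB] := BP T TTT; apply: based_on_subset (TB _ Tx) => y By.
  by exists T.
Qed.

Lemma reflected_cofinal : Q setT ->
  cofinal [set T : subCu S | Sub_ctbl T /\ P T].
Proof.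
move=> HC T0 /countably_basedP[B0 [cB0 _ T0B]].
have [B [[cB B0B] B0' BD BB QB]] := countable_reflecting_hull HC cB0.
have [R RE] := based_on_subCu B0' BD BB.
exists R; last by rewrite RE; apply: subset_trans T0B (based_on_subset B0B).
split; last by apply/PQ; rewrite RE; apply: Q_based_on.
by apply/countably_basedP; exists B; rewrite RE; split.
Qed.

Lemma reflected_sigma_complete_cofinal : Q setT ->
  sigma_complete [set T : subCu S | Sub_ctbl T /\ P T] /\
  cofinal [set T : subCu S | Sub_ctbl T /\ P T].
Proof.
split; [exact: reflected_sigma_complete|exact: reflected_cofinal].
Qed.

End Reflection.

(** * The properties relative to a subset *)

Section Properties.
Variable S : cuType.
Implicit Types (U : set S).

Definition O5_in U : Prop :=
  forall x' x y' y z, U x' -> U x -> U y' -> U y -> U z ->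
    x + y <= z -> way_below x' x -> way_below y' y ->
    exists c, [/\ U c, x' + c <= z, z <= x + c & way_below y' c].

Definition O6_in U : Prop :=
  forall x' x y z, U x' -> U x -> U y -> U z ->
    way_below x' x -> x <= y + z ->
    exists v w,
      [/\ U v, U w & [/\ v <= x, v <= y, w <= x, w <= z & x' <= v + w]].

Definition O7_in U : Prop :=
  forall x1' x1 x2' x2 w, U x1' -> U x1 -> U x2' -> U x2 -> U w ->
    way_below x1' x1 -> x1 <= w -> way_below x2' x2 -> x2 <= w ->
    exists x, [/\ U x, way_below x1' x, way_below x2' x, x <= w & x <= x1 + x2].

Lemma O5_in_finitary : finitary O5_in.
Proof.
exists (fun l : seq S => if l is [:: x'; x; y'; y; z] then
          [/\ x + y <= z, way_below x' x & way_below y' y] else False).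
exists (fun l r : seq S => if (l, r) is ([:: x'; x; y'; y; z], [:: c]) then
          [/\ x' + c <= z, z <= x + c & way_below y' c] else False).
move=> U; split=> [UO|UO x' x y' y z Ux' Ux Uy' Uy Uz xyz x'x y'y].
- case=> [|x' [|x [|y' [|y [|z [|? ?]]]]]] //.
  do 5![move/set_seq_cons=> [?]] => _ [xyz x'x y'y].
  have [||||||||c [Uc cP1 cP2 cP3]] := UO x' x y' y z => //.
  by exists [:: c]; split=> //; apply/set_seq_cons.
- have [||[|c [|? ?]] [rU]] // := UO [:: x'; x; y'; y; z].
    by do 5?[apply/set_seq_cons; split].
  by move/set_seq_cons: rU => [Uc _] [? ? ?]; exists c.
Qed.

Lemma O6_in_finitary : finitary O6_in.
Proof.
exists (fun l : seq S => if l is [:: x'; x; y; z] then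
          way_below x' x /\ x <= y + z else False).
exists (fun l r : seq S => if (l, r) is ([:: x'; x; y; z], [:: v; w]) then
          [/\ v <= x, v <= y, w <= x, w <= z & x' <= v + w] else False).
move=> U; split=> [UO|UO x' x y z Ux' Ux Uy Uz x'x xyz].
- case=> [|x' [|x [|y [|z [|? ?]]]]] //.
  do 4![move/set_seq_cons=> [?]] => _ [x'x xyz].
  have [||||||v [w [Uv Uw vwP]]] := UO x' x y z => //.
  by exists [:: v; w]; split=> //; do 2?[apply/set_seq_cons; split].
- have [||[|v [|w [|? ?]]] [rU]] // := UO [:: x'; x; y; z].
    by do 4?[apply/set_seq_cons; split].
  by move/set_seq_cons: rU => [Uv /set_seq_cons[Uw _]] ?; exists v, w.
Qed.

Lemma O7_in_finitary : finitary O7_in.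
Proof.
exists (fun l : seq S => if l is [:: x1'; x1; x2'; x2; w] then
          [/\ way_below x1' x1, x1 <= w, way_below x2' x2 & x2 <= w]
        else False).
exists (fun l r : seq S => if (l, r) is ([:: x1'; x1; x2'; x2; w], [:: x]) then
          [/\ way_below x1' x, way_below x2' x, x <= w & x <= x1 + x2]
        else False).
move=> U; split=> [UO|UO x1' x1 x2' x2 w Ux1' Ux1 Ux2' Ux2 Uw x1W x1w x2W x2w].
- case=> [|x1' [|x1 [|x2' [|x2 [|w [|? ?]]]]]] //.
  do 5![move/set_seq_cons=> [?]] => _ [x1W x1w x2W x2w].
  have [|||||||||x [Ux xP1 xP2 xP3 xP4]] := UO x1' x1 x2' x2 w => //.
  by exists [:: x]; split=> //; apply/set_seq_cons.
- have [||[|x [|? ?]] [rU]] // := UO [:: x1'; x1; x2'; x2; w].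
    by do 5?[apply/set_seq_cons; split].
  by move/set_seq_cons: rU => [Ux _] [? ? ? ?]; exists x.
Qed.

Lemma O5_in_setT : O5 S -> O5_in setT.
Proof.
move=> SO x' x y' y z _ _ _ _ _ xyz x'x y'y.
by have [c []] := SO _ _ _ _ _ xyz x'x y'y; exists c.
Qed.

Lemma O6_in_setT : O6 S -> O6_in setT.
Proof.
move=> SO x' x y z _ _ _ _ x'x xyz.
by have [v [w ?]] := SO _ _ _ _ x'x xyz; exists v, w.
Qed.

Lemma O7_in_setT : O7 S -> O7_in setT.
Proof.
move=> SO x1' x1 x2' x2 w _ _ _ _ _ x1W x1w x2W x2w.
by have [x []] := SO _ _ _ _ _ x1W x1w x2W x2w; exists x.
Qed.

Section Carrier.
Variable T : subCu S.
Let toT (x : S) (Tx : carrier T x) : T := to_sub_pom (subCu_mon T) Tx.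

Lemma O5_carrier : O5 T <-> O5_in (carrier T).
Proof.
split=> [TO x' x y' y z Tx' Tx Ty' Ty Tz xyz x'x y'y|TO x' x y' y z xyz].
- have [|||c [c1 c2 /carrier_way_below c3]] :=
    TO (toT Tx') (toT Tx) (toT Ty') (toT Ty) (toT Tz).
  + exact: xyz.
  + exact/carrier_way_below.
  + exact/carrier_way_below.
  by exists (\val c); split=> //; apply: carrier_in.
- move=> /carrier_way_below x'x /carrier_way_below y'y.
  have [c [Tc c1 c2 c3]] := TO _ _ _ _ _ (carrier_in x') (carrier_in x)
    (carrier_in y') (carrier_in y) (carrier_in z) xyz x'x y'y.
  by exists (toT Tc); split=> //; apply/carrier_way_below.
Qed.

Lemma O6_carrier : O6 T <-> O6_in (carrier T).
Proof.
split=> [TO x' x y z Tx' Tx Ty Tz x'x xyz|TO x' x y z].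
- have [||v [w vwP]] := TO (toT Tx') (toT Tx) (toT Ty) (toT Tz).
  + exact/carrier_way_below.
  + exact: xyz.
  by exists (\val v), (\val w); split=> //; apply: carrier_in.
- move=> /carrier_way_below x'x xyz.
  have [v [w [Tv Tw vwP]]] := TO _ _ _ _ (carrier_in x') (carrier_in x)
    (carrier_in y) (carrier_in z) x'x xyz.
  by exists (toT Tv), (toT Tw).
Qed.

Lemma O7_carrier : O7 T <-> O7_in (carrier T).
Proof.
split=> [TO x1' x1 x2' x2 w|TO x1' x1 x2' x2 w].
- move=> T1' T1 T2' T2 Tw x1W x1w x2W x2w.
  have [||||x [/carrier_way_below ? /carrier_way_below ? ? ?]] :=
    TO (toT T1') (toT T1) (toT T2') (toT T2) (toT Tw).
  + exact/carrier_way_below.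
  + exact: x1w.
  + exact/carrier_way_below.
  + exact: x2w.
  by exists (\val x); split=> //; apply: carrier_in.
- move=> /carrier_way_below x1W x1w /carrier_way_below x2W x2w.
  have [x [Tx ? ? ? ?]] := TO _ _ _ _ _ (carrier_in x1') (carrier_in x1)
    (carrier_in x2') (carrier_in x2) (carrier_in w) x1W x1w x2W x2w.
  by exists (toT Tx); split=> //; apply/carrier_way_below.
Qed.

End Carrier.

End Properties.

(** * Passing to the generated sub-Cu-semigroup *)

(** The form of dependent choice needed for (O5): the invariant refers to the
    n-th approximant of a supremum, so it has to depend on the index. *)
Lemma dependent_choice_along (X : Type) (I : nat -> X -> Prop)
    (R : nat -> X -> X -> Prop) (x0 : X) :
  I 0%N x0 -> (forall n x, I n x -> exists y, I n.+1 y /\ R n x y) ->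
  exists f, f 0%N = x0 /\ forall n, I n (f n) /\ R n (f n) (f n.+1).
Proof.
move=> I0 step.
have /choice[g gP] (p : nat * X) :
    exists y, I p.1 p.2 -> I p.1.+1 y /\ R p.1 p.2 y.
  have [Ip|nIp] := pselect (I p.1 p.2); last by exists x0.
  by have [y yP] := step _ _ Ip; exists y.
pose f := fix f n := if n is m.+1 then g (m, f m) else x0.
have fI n : I n (f n) by elim: n => //= n In; case: (gP (n, f n) In).
by exists f; split=> // n; split=> //; case: (gP (n, f n) (fI n)).
Qed.

Section Closure.
Variables (S : cuType) (U : set S).
Hypothesis UU : U `<=` based_on U.

(** The element b << x lies below the sum of one approximant y1 of y and one
    approximant z1 of z, so the witnesses for a << b <= y1 + z1 serve for x. *)
Lemma O6_based_on : O6_in U -> O6_in (based_on U).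
Proof.
move=> UO x' x y z _ Ux Uy Uz x'x xyz.
have [b [Ub x'b bx]] := Ux _ x'x; have [a [Ua x'a ab]] := UU Ub x'b.
have [y1 [z1 [Uy1 Uz1 y1y z1z b_le]]] :=
  based_onD_below Uy Uz (way_below_le_trans bx xyz).
have [v [w [Uv Uw [vb vy wb wz avw]]]] := UO a b y1 z1 Ua Ub Uy1 Uz1 ab b_le.
have /way_below_le le_bx := bx.
exists v, w; split; [exact: UU|exact: UU|split].
- exact: le_trans le_bx.
- exact: le_trans vy (way_below_le y1y).
- exact: le_trans le_bx.
- exact: le_trans wz (way_below_le z1z).
- exact: le_trans (way_below_le x'a) avw.
Qed.

(** Directedness gives one approximant u of w above both b1 << x1 and b2 << x2,
    and the witness for the b's below u serves for the x's below w. *)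
Lemma O7_based_on : O7_in U -> O7_in (based_on U).
Proof.
move=> UO x1' x1 x2' x2 w _ U1 _ U2 Uw x1W x1w x2W x2w.
have [b1 [Ub1 xb1 bx1]] := U1 _ x1W; have [a1 [Ua1 xa1 ab1]] := UU Ub1 xb1.
have [b2 [Ub2 xb2 bx2]] := U2 _ x2W; have [a2 [Ua2 xa2 ab2]] := UU Ub2 xb2.
have [u [Uu /way_below_le b1u /way_below_le b2u /way_below_le uw]] :=
  based_on_directed Uw (way_below_le_trans bx1 x1w)
    (way_below_le_trans bx2 x2w).
have [x [Ux a1x a2x xu xb]] :=
  UO a1 b1 a2 b2 u Ua1 Ub1 Ua2 Ub2 Uu ab1 b1u ab2 b2u.
exists x; split.
- exact: UU.
- exact: way_below_trans xa1 a1x.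
- exact: way_below_trans xa2 a2x.
- exact: le_trans xu uw.
- by apply: le_trans xb _; apply: pom_leD; apply: way_below_le.
Qed.

(** The bound a + c <= z makes c small enough for the approximant z, and u << c
    is the part of it to be kept.  Relative (O5) applied to a' << a, u << c and
    a + c <= z1 gives a witness c' for the next approximant z1, with u << c' and
    z1 <= a + c'.  As z << z1, some u' << c' in U that is above u is large enough
    for z <= x + u'.  The price is that a shrinks to a', but it stays above
    x'. *)
Lemma O5_step (x' x u a c z z1 : S) : O5_in U ->
  U u -> U a -> U c -> U z1 ->
  way_below x' a -> a <= x -> way_below u c -> a + c <= z -> way_below z z1 ->
  exists u' a' c', [/\ U u', U a', U c', way_below u u' & z <= x + u'] /\
    [/\ way_below x' a', a' <= x, way_below u' c' & a' + c' <= z1].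
Proof.
move=> UO Uu Ua Uc Uz1 x'a ax uc acz zz1.
have [a' [Ua' x'a' a'a]] := UU Ua x'a.
have acz1 := le_trans acz (way_below_le zz1).
have [c' [Uc' a'c' z1ac' uc']] := UO a' a u c z1 Ua' Ua Uu Uc Uz1 acz1 a'a uc.
have z1xc' : z1 <= x + c' by apply: le_trans z1ac' (pom_leD ax (lexx _)).
have [t [tU tW tc']] := based_on_seq_sup (UU Uc').
have ti := way_below_increasing tW.
have [m zm] := zz1 _ _ (increasing_seqDl x ti) (seq_supDl x ti tc') z1xc'.
have [k uk] := uc' t c' ti tc' (lexx _).
exists (t (maxn m k).+1), a', c'; split; split=> //.
- by apply: le_way_below (tW _); apply: le_trans uk (ti _ _ (leq_maxr _ _)).
- apply: le_trans zm (pom_leD (lexx _) (ti _ _ _)).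
  exact: leq_trans (leq_maxl _ _) (leqnSn _).
- exact: le_trans (way_below_le a'a) ax.
- exact: seq_sup_way_below.
Qed.

(** [O5_step] is iterated along a <<-increasing sequence w in U with supremum
    z.  The elements u found on the way form a <<-increasing sequence f.  Up to
    a shift k of the index, x' + f n <= w n and w n <= x + f n.+1, so that the
    supremum of f is the required witness by (O4). *)
Lemma O5_based_on : O5_in U -> O5_in (based_on U).
Proof.
move=> UO x' x y' y z _ Ux _ Uy Uz xyz x'x y'y.
have [a [Ua x'a ax]] := Ux _ x'x.
have [e [Ue y'e ey]] := Uy _ y'y; have [d [Ud y'd de]] := UU Ue y'e.
have [w [wU wW wz]] := based_on_seq_sup Uz.
have wi := way_below_increasing wW.
have [k aek] := Cu_O3 (cu_axioms S) ax ey wi wz xyz.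
(* The index is shifted by k so that the first witness e for y is small
   enough for the first approximant of z. *)
pose I n u := U u /\ exists a c, [/\ U a, U c, way_below x' a & a <= x] /\
  (way_below u c /\ a + c <= w (n + k)%N).
pose R n u u' := way_below u u' /\ w (n + k)%N <= x + u'.
have [||f [f0 fP]] := @dependent_choice_along _ I R d.
- split=> //; exists a, e; split; split=> //.
  exact: way_below_le.
- move=> n u [Uu [b [c [[Ub Uc x'b bx] [uc bc]]]]].
  have [u' [b' [c' [[Uu' Ub' Uc' uu' wu'] [x'b' b'x u'c' bc']]]]] :=
    O5_step UO Uu Ub Uc (wU _) x'b bx uc bc (wW (n + k)%N).
  by exists u'; split=> //; split=> //; exists b', c'.
have fW n : way_below (f n) (f n.+1) by have [_ []] := fP n.
have fi := way_below_increasing fW.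
have [c cf] := Cu_O1 (cu_axioms S) fi.
exists c; split.
- by apply: seq_sup_based_on fW cf => n; have [[]] := fP n.
- apply: (seq_sup_le (seq_supDl x' fi cf)) => n.
  have [[_ [b [g [[_ _ x'b _] [fg bg]]]]] _] := fP n.
  apply: le_trans (pom_leD (way_below_le x'b) (way_below_le fg)) _.
  by apply: le_trans bg _; apply: seq_sup_ub wz.
- apply: (seq_sup_le wz) => n; have [_ [_ wf]] := fP n.
  apply: le_trans (wi _ _ (leq_addr k n)) (le_trans wf _).
  by apply: pom_leD; rewrite ?lexx //; apply: seq_sup_ub cf.
- apply: way_below_le_trans y'd _; rewrite -f0; exact: seq_sup_ub cf.
Qed.

End Closure.

Theorem proposition5p3 :
  (forall P : cuType -> Prop, [\/ P = O5, P = O6 | P = O7] ->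
    forall S : cuType, P S ->
      sigma_complete [set T : subCu S | Sub_ctbl T /\ P T] /\
      cofinal [set T : subCu S | Sub_ctbl T /\ P T]) /\
  [/\ Lowenheim_Skolem O5, Lowenheim_Skolem O6 & Lowenheim_Skolem O7].
Proof.
have main P : [\/ P = O5, P = O6 | P = O7] -> forall S : cuType, P S ->
    sigma_complete [set T : subCu S | Sub_ctbl T /\ P T] /\
    cofinal [set T : subCu S | Sub_ctbl T /\ P T].
  case=> -> S PS.
  - apply: (@reflected_sigma_complete_cofinal S (@O5_in S)).
    + exact: O5_in_finitary.
    + exact: O5_carrier.
    + exact: O5_based_on.
    + exact: O5_in_setT.
  - apply: (@reflected_sigma_complete_cofinal S (@O6_in S)).
    + exact: O6_in_finitary.
    + exact: O6_carrier.
    + exact: O6_based_on.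
    + exact: O6_in_setT.
  - apply: (@reflected_sigma_complete_cofinal S (@O7_in S)).
    + exact: O7_in_finitary.
    + exact: O7_carrier.
    + exact: O7_based_on.
    + exact: O7_in_setT.
have LS P : [\/ P = O5, P = O6 | P = O7] -> Lowenheim_Skolem P.
  move=> PE S PS; have [sc cof] := main P PE S PS.
  by exists [set T : subCu S | Sub_ctbl T /\ P T]; split=> // T [].
by split=> //; split; apply: LS; [constructor 1|constructor 2|constructor 3].
Qed.
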